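(* Let $(\Omega,\mathcal F)$ be a measurable space with a filtration $\{\mathcal F_m\}_{m=0}^\infty$, $\mathcal F_0=\{\emptyset,\Omega\}$, and let $M$ be a convex set of equivalent measures on $\mathcal F$. Let $\{f_m,\mathcal F_m\}_{m=0}^\infty$ be a supermartingale relative to $M$ belonging to the class $F$ (i.e. $\sup_{P\in M}E^P|f_m|<\infty$ for all $m\ge0$), and suppose there exists a nonnegative adapted random process $\{\bar g_m^0\}_{m=1}^\infty$, $E^P\bar g_m^0<\infty$ for $m\ge 1$, $P\in M$, such that $$f_{m-1}-E^P\{f_m|\mathcal F_{m-1}\}=E^P\{\bar g_m^0|\mathcal F_{m-1}\},\qquad m=1,2,\dots,\quad P\in M.$$ Then $\{f_m,\mathcal F_m\}_{m=0}^\infty$ is a local regular supermartingale.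
   Context: Setting. $(\Omega,\mathcal F)$ is a measurable space with filtration $\mathcal F_m\subset\mathcal F_{m+1}\subset\mathcal F$, $m=0,1,2,\dots$, $\mathcal F_0=\{\emptyset,\Omega\}$. $M$ is a convex set of mutually equivalent probability measures on $\mathcal F$; $E^P$ is expectation under $P$. A process $\{\psi_m\}$ is adapted if $\psi_m$ is $\mathcal F_m$-measurable for all $m$. An adapted process $\{f_m\}$ is a supermartingale relative to $M$ if $E^P|f_m|<\infty$ for $m\ge 1$, $P\in M$, and $E^P\{f_m|\mathcal F_k\}\le f_k$ for $0\le k\le m$, $P\in M$. Regular supermartingale. Let $\{f_m,\mathcal F_m\}$ be a supermartingale relative to $M$ for which there are a random variable $\varphi$ and a real $T$ with ( * ) $|f_m|\le\varphi$ for all $m\ge 0$ and $E^Q\varphi<T<\infty$ for all $Q\in M$ ($T$ not depending on $Q$). For $\hat P_1,\dots,\hat P_s\in M$ put $\hat M_s=\{\sum_{i=1}^s\gamma_i\hat P_i:\gamma_i\ge0,\sum_i\gamma_i=1\}$ and let $G_s$ be the set of adapted non-decreasing processes $g=\{g_m\}_{m=0}^\infty$, $g_0=0$, such that $\{f_m+g_m\}$ is a supermartingale relative to all measures in $\hat M_s$. Processes are partially ordered by $g^1\preceq g^2$ iff $g^1_m\le g^2_m$ almost surely for all $m$; a maximal chain is a totally ordered subset maximal under inclusion. The supermartingale is called regular if for every finite family $\hat P_1,\dots,\hat P_s\in M$ satisfying $0<l\le \frac{d\hat P_i}{d\hat P_j}\le L<\infty$, $i,j=1,\dots,s$ (with real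 $l,L$ depending on the family): (i) there exist $1\le m_0<\infty$ and an $\mathcal F_{m_0-1}$-measurable nonnegative random variable $\varphi_{m_0}^s$ with $\hat P_1(\varphi_{m_0}^s>0)>0$ such that $f_{m_0-1}-E^{\hat P_i}\{f_{m_0}|\mathcal F_{m_0-1}\}\ge\varphi_{m_0}^s$, $i=1,\dots,s$; (ii) for the maximal element $g^s=\{g^s_m\}$ in a certain maximal chain $\tilde G_s\subseteq G_s$, $E^{\hat P_i}\{f_m+g^s_m|\mathcal F_k\}=f_k+g_k^s$ for $0\le k\le m$, $m\ge1$, $i=1,\dots,s$; and moreover (iii) there exists an adapted nonnegative process $\bar g^0=\{\bar g^0_m\}_{m=0}^\infty$, $\bar g^0_0=0$, $E^P\bar g_m^0<\infty$ for $m\ge1$, $P\in M$, not depending on the family $\hat P_1,\dots,\hat P_s$, such that $E^{\hat P_i}\{g_m^s-g_{m-1}^s|\mathcal F_{m-1}\}=E^{\hat P_i}\{\bar g^0_m|\mathcal F_{m-1}\}$ for $m\ge1$, $i=1,\dots,s$. Local regular supermartingale. A supermartingale $f\in F$ (i.e. $\sup_{P\in M}E^P|f_m|<\infty$ for all $m\ge0$) is local regular if there is an increasing sequence of nonrandom times $\tau_{k_s}=k_s<\infty$, $k_s\to\infty$ as $s\to\infty$, such that for every $s$ the stopped process $\{f_{m\wedge k_s},\mathcal F_m\}_{m=0}^\infty$ is a regular supermartingale relative to $M$.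
   Formalization: Added assumption: the supermartingale is not a martingale under any P in M; otherwise the claim is false (e.g. f = 0, ḡ⁰ = 0, M = {P}), since clause (i) of regularity demands a strictly positive drop with positive probability. *)

(* Defs.v *)
From mathcomp Require Import all_boot all_order all_algebra.
From mathcomp Require Import all_classical all_reals all_analysis.
Import Order.TTheory GRing.Theory Num.Theory.
Import numFieldNormedType.Exports.

Set Implicit Arguments.
Unset Strict Implicit.
Unset Printing Implicit Defensive.

Local Open Scope classical_set_scope.
Local Open Scope charge_scope.
Local Open Scope ring_scope.

Section Processes.
Context {d : measure_display} {Omega : measurableType d} {R : realType}.

(* A sub-sigma-algebra is a set of subsets of Omega. *)
Definition measurable_wrt (G : set (set Omega)) (X : Omega -> R) : Prop :=
  forall B : set R, measurable B -> G (X @^-1` B).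

Definition filtration (F : nat -> set (set Omega)) : Prop :=
  [/\ forall m, sigma_algebra setT (F m),
      forall m, F m `<=` F m.+1,
      forall m, F m `<=` measurable &
      F 0%N = [set A | A = set0 \/ A = setT]].

Definition adapted (F : nat -> set (set Omega)) (psi : nat -> Omega -> R) :=
  forall m, measurable_wrt (F m) (psi m).

(* Y is a version of E^P{X | G}.  Versions are unique up to P-null sets, and
   exist as soon as X is P-integrable and G is a sub-sigma-algebra; relations
   between conditional expectations are stated below through the existence of
   versions satisfying them almost surely, so that the existence of the
   conditional expectations is part of what is claimed. *)
Definition is_condexp (P : probability Omega R) (G : set (set Omega))
    (X Y : Omega -> R) : Prop :=
  [/\ P.-integrable setT (EFin \o X),
      measurable_wrt G Y,
      P.-integrable setT (EFin \o Y) &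
      forall A, G A ->
        (\int[P]_(w in A) (Y w)%:E = \int[P]_(w in A) (X w)%:E)%E].

Definition supermartingale (F : nat -> set (set Omega))
    (M : set (probability Omega R)) (f : nat -> Omega -> R) : Prop :=
  [/\ adapted F f,
      forall m P, (1 <= m)%N -> M P -> ('E_P[fun w => (`|f m w|)%R] < +oo)%E &
      forall k m P, (k <= m)%N -> M P ->
        exists2 Y, is_condexp P (F k) (f m) Y &
          {ae P, forall w, Y w <= f k w}].

Definition martingale (F : nat -> set (set Omega))
    (M : set (probability Omega R)) (f : nat -> Omega -> R) : Prop :=
  [/\ adapted F f,
      forall m P, (1 <= m)%N -> M P -> ('E_P[fun w => (`|f m w|)%R] < +oo)%E &
      forall k m P, (k <= m)%N -> M P -> is_condexp P (F k) (f m) (f k)].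

(* Probabilities are identified with their values on measurable sets (a
   measure in the library also takes irrelevant values elsewhere), here and in
   [mixtures]. *)
Definition convex_measures (M : set (probability Omega R)) : Prop :=
  forall P Q, M P -> M Q -> forall t : R, 0 <= t <= 1 ->
    exists2 S, M S &
      forall A, measurable A -> S A = (t%:E * P A + (1 - t)%:E * Q A)%E.

Definition equivalent_measures (M : set (probability Omega R)) : Prop :=
  forall P Q, M P -> M Q -> P `<< Q.

Definition class_F (M : set (probability Omega R)) (f : nat -> Omega -> R) :=
  forall m, (ereal_sup [set 'E_P[fun w => (`|f m w|)%R] | P in M] < +oo)%E.

Definition mixtures (s : nat) (P : 'I_s.+1 -> probability Omega R) :
    set (probability Omega R) :=
  [set Q | exists gamma : 'I_s.+1 -> R,
    [/\ forall i, 0 <= gamma i,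
        \sum_i gamma i = 1 &
        forall A, measurable A -> Q A = (\sum_i (gamma i)%:E * P i A)%E]].

Definition bounded_densities (s : nat) (P : 'I_s.+1 -> probability Omega R) :=
  exists l L : R, 0 < l /\ forall i j,
    {ae P j, forall w,
      (l%:E <= ('d (charge_of_finite_measure (P i)) '/d (P j)) w <= L%:E)%E}.

Definition compensators (F : nat -> set (set Omega))
    (M : set (probability Omega R)) (f : nat -> Omega -> R) :
    set (nat -> Omega -> R) :=
  [set g | [/\ adapted F g,
    forall m w, g m w <= g m.+1 w,
    forall w, g 0%N w = 0 &
    supermartingale F M (fun m w => f m w + g m w)]].

(* A preorder; antisymmetric up to almost sure equality. *)
Definition process_le (M : set (probability Omega R))
    (g1 g2 : nat -> Omega -> R) : Prop :=
  forall P, M P -> forall m, {ae P, forall w, g1 m w <= g2 m w}.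

Definition maximal_chain (T : Type) (le : T -> T -> Prop) (G C : set T) :=
  [/\ C `<=` G, total_on C le &
      forall C', C' `<=` G -> total_on C' le -> C `<=` C' -> C' = C].

Definition maximal_in (T : Type) (le : T -> T -> Prop) (C : set T) (g : T) :=
  C g /\ forall h, C h -> le g h -> le h g.

Definition regular_drop (F : nat -> set (set Omega)) (f : nat -> Omega -> R)
    (s : nat) (P : 'I_s.+1 -> probability Omega R) : Prop :=
  exists (m0 : nat) (phi : Omega -> R),
    [/\ (1 <= m0)%N,
        measurable_wrt (F m0.-1) phi,
        forall w, 0 <= phi w,
        (0 < P ord0 [set w | (0 < phi w)%R])%E &
        forall i, exists2 Y, is_condexp (P i) (F m0.-1) (f m0) Y &
          {ae P i, forall w, phi w <= f m0.-1 w - Y w}].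

Definition regular (F : nat -> set (set Omega))
    (M : set (probability Omega R)) (f : nat -> Omega -> R) : Prop :=
  [/\ supermartingale F M f,
      exists (phi : Omega -> R) (T : R),
        [/\ measurable_fun setT phi,
            forall m w, `|f m w| <= phi w &
            forall Q, M Q -> ('E_Q[phi] < T%:E)%E] &
      exists gbar : nat -> Omega -> R,
        [/\ adapted F gbar,
            forall m w, 0 <= gbar m w,
            forall w, gbar 0%N w = 0,
            forall m P, (1 <= m)%N -> M P -> ('E_P[gbar m] < +oo)%E &
            forall (s : nat) (P : 'I_s.+1 -> probability Omega R),
              (forall i, M (P i)) -> bounded_densities P ->
              regular_drop F f P /\
              exists (C : set (nat -> Omega -> R)) (g : nat -> Omega -> R),
                [/\ maximal_chain (process_le M)
                      (compensators F (mixtures P) f) C,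
                    maximal_in (process_le M) C g,
                    forall k m i, (k <= m)%N -> (1 <= m)%N ->
                      is_condexp (P i) (F k) (fun w => f m w + g m w)
                        (fun w => f k w + g k w) &
                    (* equality of conditional expectations: a common version *)
                    forall m i, (1 <= m)%N ->
                      exists2 Y,
                        is_condexp (P i) (F m.-1)
                          (fun w => g m w - g m.-1 w) Y &
                        is_condexp (P i) (F m.-1) (gbar m) Y]]].

Definition stopped (f : nat -> Omega -> R) (k : nat) : nat -> Omega -> R :=
  fun m => f (minn m k).

Definition local_regular (F : nat -> set (set Omega))
    (M : set (probability Omega R)) (f : nat -> Omega -> R) : Prop :=
  [/\ supermartingale F M f, class_F M f &
      exists k : nat -> nat,
        [/\ forall s, (k s < k s.+1)%N,
            k @ \oo --> \oo &
            forall s, regular F M (stopped f (k s))]].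

End Processes.

(* Main.v *)
(* The hypothesis makes f_m + sum_(i <= m) g0_i a martingale under every P in M,
   also after stopping at k.  The partial sums g of g0 up to min(m, k) are
   therefore compensators of the stopped process; a compensator h >= g has the
   same expectations as g by the supermartingale property, so h = g almost
   surely, and a maximal chain through g exists by Zorn's lemma.  As f is not a
   martingale, some g0_m0 does not vanish almost surely, for one and hence for
   all of the equivalent measures; stopping after time m0 leaves a drop bounded
   below by the minimum of the conditional expectations of g0_m0 under the
   finitely many P_i, which are positive on the same event up to null sets. *)
Require Import Defs.
From mathcomp Require Import all_boot all_order all_algebra.
From mathcomp Require Import all_classical all_reals all_analysis.
From mathcomp Require Import measurable_realfun.
Import Order.TTheory GRing.Theory Num.Theory.
Import numFieldNormedType.Exports.
Local Open Scope classical_set_scope.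
Local Open Scope ring_scope.

(** * Maximal chains through a prescribed element *)

Lemma maximal_chain_containing {T : Type} {le : T -> T -> Prop} {G : set T}
    {g : T} : le g g -> G g -> exists2 C, maximal_chain le G C & C g.
Proof.
move=> legg Gg.
(* [g] is adjoined inside the predicate instead of being required to lie in [C]: Zorn's lemma also
   asks about the empty family of chains, whose union is empty and does not contain [g]. *)
pose chain C := [/\ g |` C `<=` G & total_on (g |` C) le].
have [C [[CG Ctot] Cmax]] :
    exists C, chain C /\ forall B, C `<` B -> ~ chain B.
  apply: Zorn_bigcup => D Dchain Dtot; split=> [x [->//|[C DC Cx]]|].
    by have [CG _] := Dchain C DC; apply: CG; right.
  move=> x y [->|[C1 D1 C1x]] [->|[C2 D2 C2y]]; first by left.
  - by have [_] := Dchain _ D2; apply; [left|right].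
  - by have [_] := Dchain _ D1; apply; [right|left].
  - have [C12|C21] := Dtot _ _ D1 D2.
    + by have [_] := Dchain _ D2; apply; right => //; apply: C12.
    + by have [_] := Dchain _ D1; apply; right => //; apply: C21.
exists (g |` C); last by left.
split=> // C' C'G C'tot CC'.
(* A larger chain already contains [g], so adjoining [g] does not change it and it satisfies
   [chain], against the maximality of [C]. *)
have gC' : g |` C' = C'.
  by apply/seteqP; split=> [x [->|//]|x]; [apply: CC'; left|right].
apply: contrapT => neq; apply: (Cmax C').
  split; first by move=> x Cx; apply: CC'; right.
  move=> C'C; apply: neq; apply/seteqP; split=> // x /C'C; by right.
by split; rewrite gC'.
Qed.

(** * Functions measurable with respect to a sub-sigma-algebra *)

Section Measurability.
Context {d : measure_display} {Omega : measurableType d} {R : realType}.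
Implicit Types (G : set (set Omega)) (X Y : Omega -> R).

(** A sigma-algebra generates itself, so measurability for [G] is ordinary measurability once
    [Omega] carries the structure generated by [G]; closure under sums, minima and maxima is
    inherited this way. *)
Lemma measurable_wrtP {G X} : sigma_algebra setT G ->
  measurable_wrt G X <-> measurable_fun setT (X : g_sigma_algebraType G -> R).
Proof.
move=> sG; split=> mX.
  by move=> _ B mB; rewrite setTI /measurable /= sigma_algebra_id//; exact: mX.
move=> B mB; have := mX measurableT B mB.
by rewrite setTI {1}/measurable /= sigma_algebra_id.
Qed.

Lemma measurable_wrtS {G1 G2 X} :
  G1 `<=` G2 -> measurable_wrt G1 X -> measurable_wrt G2 X.
Proof. by move=> G12 mX B /mX /G12. Qed.

Lemma measurable_wrtT {G X} :
  G `<=` measurable -> measurable_wrt G X -> measurable_fun setT X.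
Proof. by move=> Gm mX _ B mB; rewrite setTI; apply/Gm/mX. Qed.

Lemma filtration_le {F : nat -> set (set Omega)} {m n : nat} : filtration F ->
  (m <= n)%N -> F m `<=` F n.
Proof.
move=> [_ FS _ _] /subnK <-; elim: (n - m)%N => [//|j IH].
exact: subset_trans IH (FS _).
Qed.

Lemma measurable_wrt_cst {G} (c : R) : sigma_algebra setT G ->
  measurable_wrt G (cst c : Omega -> R).
Proof. by move=> sG; apply/measurable_wrtP => //; exact: measurable_cst. Qed.

Lemma measurable_wrtD {G X Y} : sigma_algebra setT G ->
  measurable_wrt G X -> measurable_wrt G Y ->
  measurable_wrt G (fun w => X w + Y w).
Proof.
move=> sG /(measurable_wrtP sG) mX /(measurable_wrtP sG) mY.
by apply/measurable_wrtP => //; exact: measurable_funD.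
Qed.

Lemma measurable_wrt_sum {G} {n : nat} {X : nat -> Omega -> R} :
  sigma_algebra setT G ->
  (forall i, (i < n)%N -> measurable_wrt G (X i)) ->
  measurable_wrt G (fun w => \sum_(i < n) X i w).
Proof.
move=> sG; elim: n => [_|n IH mX].
  by under eq_fun do rewrite big_ord0; exact: measurable_wrt_cst.
under eq_fun do rewrite big_ord_recr /=.
by apply: measurable_wrtD => //; [apply: IH => i /leqW /mX|exact: mX].
Qed.

Lemma measurable_wrt_bigmin {G} {I : Type} {r : seq I} {c : R}
    {X : I -> Omega -> R} : sigma_algebra setT G ->
  (forall i, measurable_wrt G (X i)) ->
  measurable_wrt G (fun w => \big[Num.min/c]_(i <- r) X i w).
Proof.
move=> sG mX; elim: r => [|i r IH].
  by under eq_fun do rewrite big_nil; exact: measurable_wrt_cst.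
under eq_fun do rewrite big_cons.
by apply/measurable_wrtP => //; apply: measurable_minr; apply/measurable_wrtP.
Qed.

End Measurability.

(** * Almost sure inequalities and their integrals *)

Section Integrals.
Context {d : measure_display} {Omega : measurableType d} {R : realType}.
Implicit Types (P Q : probability Omega R) (X Y : Omega -> R).

Lemma ae_dominated {P Q} {p : Omega -> Prop} : P `<< Q ->
  {ae Q, forall w, p w} -> {ae P, forall w, p w}.
Proof.
move=> /null_content_dominatesP PQ [N [mN QN0 pN]].
by exists N; split=> //; apply: PQ.
Qed.

(** Almost everywhere on [D] the difference is nonnegative and equals its absolute value. Both the
    monotonicity of the integral and its equality case follow from this identity. *)
Lemma ae_le_integral_dist {P} {D : set Omega} {X Y} : measurable D ->
  P.-integrable setT (EFin \o X) -> P.-integrable setT (EFin \o Y) ->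
  {ae P, forall w, D w -> X w <= Y w} ->
  (\int[P]_(w in D) `|(Y w)%:E - (X w)%:E| =
   \int[P]_(w in D) (Y w)%:E - \int[P]_(w in D) (X w)%:E)%E.
Proof.
move=> mD iX iY XY.
have iXD := integrableS measurableT mD (@subsetT _ D) iX.
have iYD := integrableS measurableT mD (@subsetT _ D) iY.
have mYX := measurable_int _ (integrableB mD iYD iXD).
rewrite -(integralB mD iYD iXD).
apply: ae_eq_integral => //.
  exact: measurableT_comp.
by apply: filterS XY => w XYw /XYw /= {}XYw; rewrite ger0_norm ?subr_ge0.
Qed.

Lemma ae_le_integral {P} {D : set Omega} {X Y} : measurable D ->
  P.-integrable setT (EFin \o X) -> P.-integrable setT (EFin \o Y) ->
  {ae P, forall w, D w -> X w <= Y w} ->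
  (\int[P]_(w in D) (X w)%:E <= \int[P]_(w in D) (Y w)%:E)%E.
Proof.
move=> mD iX iY XY.
have iXD := integrableS measurableT mD (@subsetT _ D) iX.
rewrite -sube_ge0; first by rewrite -ae_le_integral_dist// integral_ge0.
by rewrite (integrable_fin_num mD iXD).
Qed.

(** Equality case of monotonicity: the distance of [X] and [Y] in mean over [D] is zero, so they
    agree almost everywhere there. *)
Lemma ae_ge_of_integral {P} {D : set Omega} {X Y} : measurable D ->
  P.-integrable setT (EFin \o X) -> P.-integrable setT (EFin \o Y) ->
  {ae P, forall w, D w -> X w <= Y w} ->
  (\int[P]_(w in D) (Y w)%:E <= \int[P]_(w in D) (X w)%:E)%E ->
  {ae P, forall w, D w -> Y w <= X w}.
Proof.
move=> mD iX iY XY leYX.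
have iXD := integrableS measurableT mD (@subsetT _ D) iX.
have iYD := integrableS measurableT mD (@subsetT _ D) iY.
have mYX := measurable_int _ (integrableB mD iYD iXD).
have : ae_eq P D (fun w => ((EFin \o Y) w - (EFin \o X) w)%E) (cst 0%E).
  apply/(ae_eq_integral_abs _ mD mYX)/le_anti.
  rewrite integral_ge0 ?andbT// ae_le_integral_dist// leeBlDr ?add0e//.
  exact: (integrable_fin_num mD iXD).
apply: filterS => w + Dw => /(_ Dw) /= /eqP.
by rewrite -EFinB eqe subr_eq0 => /eqP ->.
Qed.

Lemma integrable_expectation_abs {P X} : P.-integrable setT (EFin \o X) ->
  ('E_P[fun w => `|X w|%R] < +oo)%E.
Proof. by move=> /integrableP[_]; rewrite unlock. Qed.

(** * Integration against a finite mixture of probabilities *)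

Section Mixture.
Context {s : nat} {P : 'I_s.+1 -> probability Omega R}.
Context {Q : probability Omega R} {gamma : 'I_s.+1 -> R}.
Context (gamma_ge0 : forall i, 0 <= gamma i).
Context (QE : forall A, measurable A ->
  Q A = (\sum_i (gamma i)%:E * P i A)%E).

Lemma ge0_integral_mixture {D : set Omega} {h : Omega -> \bar R} :
  measurable D -> measurable_fun D h -> (forall w, D w -> (0 <= h w)%E) ->
  (\int[Q]_(w in D) h w = \sum_i (gamma i)%:E * \int[P i]_(w in D) h w)%E.
Proof.
move=> mD mh h0.
(* [msum] takes a sequence of measures indexed by [nat]; [inord] extends the finite family to one,
   and only the first [s.+1] terms are summed. *)
pose m_ (n : nat) : {measure set Omega -> \bar R} :=
  mscale (NngNum (gamma_ge0 (inord n))) (P (inord n)).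
rewrite (eq_measure_integral (msum m_ s.+1)); last first.
  move=> A mA _; apply: etrans (QE A mA) _; apply: eq_bigr => i _.
  by rewrite /m_ /mscale /= inord_val.
rewrite ge0_integral_measure_sum//; apply: eq_bigr => i _.
by rewrite ge0_integral_mscale//= inord_val.
Qed.

Lemma integrable_mixture {D : set Omega} {h : Omega -> \bar R} :
  measurable D -> (forall i, (P i).-integrable D h) -> Q.-integrable D h.
Proof.
move=> mD ih; have mh := measurable_int _ (ih ord0).
apply/integrableP; split=> //; rewrite ge0_integral_mixture//.
- apply: lte_sum_pinfty => i _.
  by apply: lte_mul_pinfty; rewrite ?lee_fin//; have /integrableP[] := ih i.
- exact: measurableT_comp.
Qed.

Lemma integral_mixture {D : set Omega} {h : Omega -> \bar R} :
  measurable D -> (forall i, (P i).-integrable D h) ->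
  (\int[Q]_(w in D) h w = \sum_i (gamma i)%:E * \int[P i]_(w in D) h w)%E.
Proof.
move=> mD ih; have mh := measurable_int _ (ih ord0).
(* The negative parts have finite integrals, which permits distributing the sum and the weights over
   the difference of positive and negative parts. *)
have iN i := integrable_fin_num mD (integrable_funeneg mD (ih i)).
rewrite integralE ge0_integral_mixture//; last exact: measurable_funepos.
rewrite ge0_integral_mixture//; last exact: measurable_funeneg.
rewrite -fin_num_sumeN; last by move=> i _; apply: fin_numM; [|exact: iN].
rewrite -big_split; apply: eq_bigr => i _.
rewrite [in RHS]integralE [in RHS]muleBr//.
by apply: fin_num_adde_defl; rewrite fin_numN; exact: iN.
Qed.

End Mixture.
End Integrals.

(** * Conditional expectations: mixtures, sign and tower property *)

Section Condexp.
Context {d : measure_display} {Omega : measurableType d} {R : realType}.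
Implicit Types (P Q : probability Omega R) (G : set (set Omega)).
Implicit Types (F : nat -> set (set Omega)) (X Y : Omega -> R).

Lemma is_condexp_refl {P G X} : measurable_wrt G X ->
  P.-integrable setT (EFin \o X) -> is_condexp P G X X.
Proof. by []. Qed.

(** The integral over a fixed event is linear in the measure, so the defining identities add up with
    the weights [gamma]. It matters that one version [Y] serves all [P i], since conditional
    expectation is not affine in the measure. *)
Lemma is_condexp_mixture {s : nat} {P : 'I_s.+1 -> probability Omega R}
    {Q G X Y} :
  G `<=` measurable -> mixtures P Q ->
  (forall i, is_condexp (P i) G X Y) -> is_condexp Q G X Y.
Proof.
move=> Gm [gamma [gamma_ge0 _ QE]] XY.
have iX i : (P i).-integrable setT (EFin \o X) by have [] := XY i.
have iY i : (P i).-integrable setT (EFin \o Y) by have [] := XY i.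
split.
- exact: (integrable_mixture gamma_ge0 QE measurableT iX).
- by have [] := XY ord0.
- exact: (integrable_mixture gamma_ge0 QE measurableT iY).
- move=> A GA; have mA := Gm _ GA.
  rewrite (integral_mixture gamma_ge0 QE mA); last first.
    by move=> i; exact: integrableS measurableT mA (@subsetT _ A) (iY i).
  rewrite (integral_mixture gamma_ge0 QE mA); last first.
    by move=> i; exact: integrableS measurableT mA (@subsetT _ A) (iX i).
  by apply: eq_bigr => i _; have [_ _ _ ->] := XY i.
Qed.

Lemma mixtures_vertex {s : nat} (P : 'I_s.+1 -> probability Omega R) i :
  mixtures P (P i).
Proof.
exists (fun j => (j == i)%:R); split=> [j|| A mA]; first exact: ler0n.
- by rewrite (bigD1 i)//= eqxx big1 ?addr0// => j /negbTE ->.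
- rewrite (bigD1 i)//= eqxx mul1e big1 ?adde0// => j /negbTE ->.
  by rewrite mul0e.
Qed.

(** On the event [Y <= 0], which belongs to [G], the integral of [Y] equals that of [X] and is
    nonnegative; hence [Y] vanishes almost surely there. *)
Lemma is_condexp_ge0 {P G X Y} : G `<=` measurable -> is_condexp P G X Y ->
  (forall w, 0 <= X w) -> {ae P, forall w, 0 <= Y w}.
Proof.
move=> Gm [iX mY iY XY] X0.
pose D := Y @^-1` `]-oo, 0].
have GD : G D by apply: mY; exact: measurable_itv.
have i0 : P.-integrable setT (EFin \o (cst 0 : Omega -> R)).
  exact: integrable0.
have := @ae_ge_of_integral _ _ _ P D Y (cst 0) (Gm _ GD) iY i0.
have YD w : D w -> Y w <= 0 by rewrite /D /= in_itv.
move=> /(_ (aeW _ YD)); rewrite XY// integral0.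
have X0' : (0 <= \int[P]_(w in D) (X w)%:E)%E.
  by apply: integral_ge0 => w _; rewrite lee_fin.
move=> /(_ X0'); apply: filterS => w Y0; have [//|Y_lt0] := leP 0 (Y w).
by rewrite -(lt_geF Y_lt0); apply: Y0; rewrite /D /= in_itv /= ltW.
Qed.

(** On the event [Y <= 0] of [G] the nonnegative [X] has the same integral as [Y], hence a
    nonpositive one. Thus, up to a null set, [X] can be positive only where its conditional
    expectation is. *)
Lemma is_condexp_null {P G X Y} : G `<=` measurable -> is_condexp P G X Y ->
  (forall w, 0 <= X w) -> {ae P, forall w, Y w <= 0 -> X w <= 0}.
Proof.
move=> Gm [iX mY iY XY] X0.
pose D := Y @^-1` `]-oo, 0].
have GD : G D by apply: mY; exact: measurable_itv.
have i0 : P.-integrable setT (EFin \o (cst 0 : Omega -> R)).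
  exact: integrable0.
have := @ae_ge_of_integral _ _ _ P D (cst 0) X (Gm _ GD) i0 iX.
move=> /(_ (aeW _ (fun w _ => X0 w))); rewrite -XY//.
have Y0 : (\int[P]_(w in D) (Y w)%:E <= \int[P]_(w in D) (cst 0%R w)%:E)%E.
  apply: ae_le_integral => //; first exact: Gm.
  by apply: aeW => w; rewrite /D /= in_itv.
by move=> /(_ Y0); apply: filterS => w + Yw; apply; rewrite /D /= in_itv.
Qed.

(** Tower property in integrated form: an event of [F k] belongs to every later [F j], so the
    one-step identities chain from [k] to [m]. *)
Lemma is_condexp_of_steps {P F} {h : nat -> Omega -> R} :
  filtration F -> adapted F h -> (forall m, P.-integrable setT (EFin \o h m)) ->
  (forall m A, F m A ->
    (\int[P]_(w in A) (h m.+1 w)%:E = \int[P]_(w in A) (h m w)%:E)%E) ->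
  forall k m, (k <= m)%N -> is_condexp P (F k) (h m) (h k).
Proof.
move=> hF ah ih step k m km; split=> // A FA.
rewrite -(subnK km); elim: (m - k)%N => [//|j ->].
by rewrite addSn step//; exact: filtration_le (leq_addl j k) A FA.
Qed.

End Condexp.

(** * Compensation and regularity of the process stopped at a fixed time *)

Section Regularity.
Context {d : measure_display} {Omega : measurableType d} {R : realType}.
Context {F : nat -> set (set Omega)} {M : set (probability Omega R)}.
Context {f g0 : nat -> Omega -> R}.
Context (hF : filtration F) (hMequiv : equivalent_measures M).
Context (hf : supermartingale F M f).
Context (hg0_adapted : forall m, (1 <= m)%N -> measurable_wrt (F m) (g0 m)).
Context (hg0_ge0 : forall m w, (1 <= m)%N -> 0 <= g0 m w).
Context (hg0 : forall m P, (1 <= m)%N -> M P ->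
  exists Y Z : Omega -> R,
    [/\ is_condexp P (F m.-1) (f m) Y,
        is_condexp P (F m.-1) (g0 m) Z &
        {ae P, forall w, f m.-1 w - Y w = Z w}]).
Implicit Types (P Q : probability Omega R) (m k : nat).

Let sF m : sigma_algebra setT (F m). Proof. by have [] := hF. Qed.

Let Fm m : F m `<=` measurable. Proof. by have [] := hF. Qed.

Lemma integrable_supermartingale P m : M P -> P.-integrable setT (EFin \o f m).
Proof. by move=> MP; have [_ _ /(_ m m P (leqnn m) MP) [Y []]] := hf. Qed.

Lemma integrable_drop P m : M P -> P.-integrable setT (EFin \o g0 m.+1).
Proof. by move=> MP; have [Y [Z [_ []]]] := hg0 m.+1 P (ltn0Sn m) MP. Qed.

(** The hypothesis on [g0] integrated over an event of [F m], where the versions [Y] and [Z] may be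
    replaced by [f m.+1] and [g0 m.+1]. *)
Lemma integral_drop P m A : M P -> F m A ->
  (\int[P]_(w in A) (f m w)%:E =
   \int[P]_(w in A) (f m.+1 w)%:E + \int[P]_(w in A) (g0 m.+1 w)%:E)%E.
Proof.
move=> MP FA; have mA := Fm _ _ FA.
have sub h : P.-integrable setT h -> P.-integrable A h.
  exact: integrableS measurableT mA (@subsetT _ A).
have [Y [Z [[_ _ iY <-//] [_ _ iZ <-//] YZ]]] := hg0 m.+1 P (ltn0Sn m) MP.
have iYA := sub _ iY; have iZA := sub _ iZ.
rewrite -(integralD mA iYA iZA); apply: ae_eq_integral => //.
- exact: measurable_int (sub _ (integrable_supermartingale _ m MP)).
- exact: measurable_int (integrableD mA iYA iZA).
- by apply: filterS YZ => w /= YZw _; rewrite -YZw -EFinD addrC subrK.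
Qed.

(** The index [m] is the same for all measures in [M]. Otherwise every drop would vanish almost
    surely under a fixed [P], and the one-step identities would make [f] a martingale under [P]. *)
Lemma exists_nontrivial_drop : (forall P, M P -> ~ martingale F [set P] f) ->
  exists m, forall P, M P -> ~ {ae P, forall w, g0 m.+1 w <= 0}.
Proof.
move=> hfnm; have [[P MP]|M0] := pselect (exists P, M P); last first.
  by exists 0%N => P MP; exfalso; apply: M0; exists P.
apply: contrapT => no_drop; apply: (hfnm P MP).
have g00 m : {ae P, forall w, g0 m.+1 w = 0}.
  have [g0_le0|g0_pos] := pselect {ae P, forall w, g0 m.+1 w <= 0}.
    by apply: filterS g0_le0 => w gw; apply/le_anti; rewrite gw hg0_ge0.
  (* By equivalence, a drop that is nontrivial under [P] is nontrivial under every [Q] in [M], so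
     [m] would be a witness. *)
  exfalso; apply: no_drop; exists m => Q MQ g0_le0; apply: g0_pos.
  exact: ae_dominated (hMequiv P Q MP MQ) g0_le0.
have [af _ _] := hf; split=> // [m Q _ ->|k m Q km ->].
  exact/integrable_expectation_abs/integrable_supermartingale.
apply: is_condexp_of_steps => // [j|j A FA].
  exact: integrable_supermartingale.
rewrite [RHS](integral_drop P j A MP FA).
rewrite [X in (_ = _ + X)%E](ae_eq_integral (cst 0%E)).
- by rewrite integral0 adde0.
- exact: Fm _ _ FA.
- apply: measurable_int.
  exact: integrableS measurableT (Fm _ _ FA) (@subsetT _ A)
    (integrable_drop _ j MP).
- exact: measurable_cst.
- by apply: filterS (g00 j) => w /= -> _.
Qed.

(** The increment from time [i] to [i.+1] is [g0 i.+1], as the assumptions on [g0] start at time 1;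
    truncation at [k] freezes the sum together with [stopped f k]. *)
Definition compensator k m (w : Omega) : R := \sum_(i < minn m k) g0 i.+1 w.

Lemma compensatorS k m w : compensator k m.+1 w =
  compensator k m w + (if (m < k)%N then g0 m.+1 w else 0).
Proof.
rewrite /compensator; case: ltnP => mk.
  by rewrite (minn_idPl mk) big_ord_recr.
by rewrite (minn_idPr (leqW mk)) addr0.
Qed.

Lemma compensator_adapted k : adapted F (compensator k).
Proof.
move=> m; apply: (measurable_wrt_sum (X := fun i => g0 i.+1)) => // i.
rewrite leq_min => /andP[im _].
by apply: measurable_wrtS (hg0_adapted i.+1 _) => //; exact: filtration_le.
Qed.

Lemma integrable_compensator P k m :
  M P -> P.-integrable setT (EFin \o compensator k m).
Proof.
move=> MP; rewrite [X in _.-integrable _ X](_ : _ =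
    fun w => (\sum_(i < minn m k) (g0 i.+1 w)%:E)%E); last first.
  by apply/funext => w; rewrite /= sumEFin.
by apply: integrable_sum => // i _; exact: integrable_drop.
Qed.

Lemma stopped_adapted k : adapted F (stopped f k).
Proof.
have [af _ _] := hf => m; apply: measurable_wrtS (af (minn m k)).
exact: filtration_le (geq_minl m k).
Qed.

Lemma stopped_supermartingale k : supermartingale F M (stopped f k).
Proof.
split; first exact: stopped_adapted.
  move=> m P _ MP.
  exact/integrable_expectation_abs/integrable_supermartingale.
move=> j m P jm MP; have [af _ fsup] := hf.
have [jk|kj] := leqP j k.
  have jmk : (j <= minn m k)%N by rewrite leq_min jm.
  have [Y] := fsup j (minn m k) P jmk MP.
  by rewrite /stopped (minn_idPl jk); exists Y.
(* From time [k] on the stopped process is constant and is its own conditional expectation. *)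
exists (stopped f k j); last exact: aeW.
have -> : stopped f k m = stopped f k j.
  rewrite /stopped (minn_idPr (ltnW kj)).
  by rewrite (minn_idPr (leq_trans (ltnW kj) jm)).
apply: is_condexp_refl.
  exact: stopped_adapted.
exact: integrable_supermartingale.
Qed.

Lemma compensated_adapted k :
  adapted F (fun m w => stopped f k m w + compensator k m w).
Proof.
move=> m; apply: measurable_wrtD => //; first exact: stopped_adapted.
exact: compensator_adapted.
Qed.

Lemma compensated_condexp P k j m : M P -> (j <= m)%N ->
  is_condexp P (F j) (fun w => stopped f k m w + compensator k m w)
    (fun w => stopped f k j w + compensator k j w).
Proof.
move=> MP; move: j m; apply: is_condexp_of_steps => //.
- exact: compensated_adapted.
- move=> m; exact: (integrableD measurableT
    (integrable_supermartingale P (minn m k) MP)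
    (integrable_compensator P k m MP)).
move=> m A FA; have mA := Fm _ _ FA.
have sub h : P.-integrable setT h -> P.-integrable A h.
  exact: integrableS measurableT mA (@subsetT _ A).
have ifA j := sub _ (integrable_supermartingale _ j MP).
have icA j := sub _ (integrable_compensator _ k j MP).
under eq_integral do rewrite EFinD.
under [RHS]eq_integral do rewrite EFinD.
rewrite [LHS](integralD mA (ifA _) (icA _)) [RHS](integralD mA (ifA _) (icA _)).
(* Before [k], the gain of the compensator makes up for the drop of [f]; from [k] on, both terms are
   frozen. *)
have [mk|km] := ltnP m k; last first.
  rewrite /stopped (minn_idPr (leqW km)) ?(minn_idPr km); congr (_ + _)%E.
  apply: eq_integral => w _; rewrite /= compensatorS ltnNge km /=.
  by rewrite addr0.
rewrite /stopped (minn_idPl mk) ?(minn_idPl (ltnW mk))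
  (integral_drop _ _ _ MP FA).
rewrite -addeA; congr (_ + _)%E; rewrite addeC.
rewrite -(integralD mA (icA _) (sub _ (integrable_drop _ m MP))).
by apply: eq_integral => w _; rewrite /= compensatorS mk.
Qed.

(** The compensated process is its own version of the conditional expectation under every [P i];
    being common to the vertices, this version passes to all mixtures. *)
Lemma compensatorsP k {s : nat} {P : 'I_s.+1 -> probability Omega R} :
  (forall i, M (P i)) ->
  compensators F (mixtures P) (stopped f k) (compensator k).
Proof.
move=> MP.
have cmart j m Q : (j <= m)%N -> mixtures P Q ->
    is_condexp Q (F j) (fun w => stopped f k m w + compensator k m w)
      (fun w => stopped f k j w + compensator k j w).
  move=> jm PQ; apply: is_condexp_mixture PQ _ => // i.
  exact: compensated_condexp.
split.
- exact: compensator_adapted.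
- move=> m w; rewrite compensatorS lerDl; case: ifP => // _.
  exact: hg0_ge0.
- by move=> w; rewrite /compensator min0n big_ord0.
- split; first exact: compensated_adapted.
    move=> m Q _ PQ; apply: integrable_expectation_abs.
    by have [] := cmart m m Q (leqnn m) PQ.
  move=> j m Q jm PQ; exists (fun w => stopped f k j w + compensator k j w).
    exact: cmart.
  exact: aeW.
Qed.

Lemma compensator_maximal k {s : nat} {P : 'I_s.+1 -> probability Omega R} h :
  (forall i, M (P i)) -> compensators F (mixtures P) (stopped f k) h ->
  process_le M (compensator k) h -> process_le M h (compensator k).
Proof.
move=> MP [_ _ h0 [_ _ hsup]] ch Q MQ m.
(* The supermartingale property of [h] is available under mixtures only, so the comparison is made
   under the vertex [P ord0] and carried to [Q] by equivalence. *)
apply: ae_dominated (hMequiv Q (P ord0) MQ (MP ord0)) _.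
have PP := mixtures_vertex P ord0.
have [Y [ih _ iY Yh] Yle] := hsup 0%N m (P ord0) (leq0n m) PP.
have [ic _ ic0 c0] := compensated_condexp (P ord0) k 0 m (MP ord0) (leq0n m).
have F0T : F 0%N setT by have [_ _ _ ->] := hF; right.
have le_ch : {ae P ord0, forall w, setT w ->
    stopped f k m w + compensator k m w <= stopped f k m w + h m w}.
  by apply: filterS (ch (P ord0) (MP ord0) m) => w cw _; rewrite lerD2l.
have := ae_ge_of_integral measurableT ic ih le_ch.
(* Integrating over the whole space, an event of [F 0], reduces both expectations to time 0, where
   [h] and the compensator vanish. *)
rewrite -(Yh _ F0T) -(c0 _ F0T).
have le_Y : {ae P ord0, forall w, setT w ->
    Y w <= stopped f k 0 w + compensator k 0 w}.
  apply: filterS Yle => w Yw _.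
  by rewrite /compensator min0n big_ord0 -(h0 w).
move=> /(_ (ae_le_integral measurableT iY ic0 le_Y)).
by apply: filterS => w /(_ I); rewrite lerD2l.
Qed.

(** * A nonzero drop before the stopping time *)

Lemma stopped_regular_drop k m {s : nat} {P : 'I_s.+1 -> probability Omega R} :
  (forall i, M (P i)) -> (m < k)%N ->
  ~ {ae P ord0, forall w, g0 m.+1 w <= 0} -> regular_drop F (stopped f k) P.
Proof.
move=> MP mk g0_pos.
have /choice [Z HZ] : forall i, exists Z, is_condexp (P i) (F m) (g0 m.+1) Z /\
    exists2 Y, is_condexp (P i) (F m) (f m.+1) Y &
      {ae P i, forall w, f m w - Y w = Z w}.
  move=> i; have [Y [Z [hY hZ YZ]]] := hg0 m.+1 (P i) (ltn0Sn m) (MP i).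
  by exists Z; split=> //; exists Y.
(* [Z i] is nonnegative only almost surely, while [phi] must be nonnegative
   everywhere. *)
pose phi w : R := \big[Num.min/1]_i Num.max 0 (Z i w).
have mphi : measurable_wrt (F m) phi.
  apply: measurable_wrt_bigmin => // i; apply/measurable_wrtP => //.
  have [[_ mZ _ _] _] := HZ i.
  apply: measurable_maxr; first exact: measurable_cst.
  exact/measurable_wrtP.
exists m.+1, phi; split=> //.
- by move=> w; apply/bigmin_geP; split=> // i _; rewrite le_max lexx.
- rewrite lt_neqAle measure_ge0 andbT eq_sym; apply/eqP => phi0; apply: g0_pos.
  have phi_le0 : {ae P ord0, forall w, ~ (0 < phi w)}.
    exists [set w | 0 < phi w]; split=> //; last by move=> w /= /contrapT.
    rewrite [X in measurable X](_ : _ = phi @^-1` `]0, +oo[); last first.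
      by apply/seteqP; split=> w /=; rewrite in_itv /= andbT.
    by apply: (Fm m); apply: mphi; exact: measurable_itv.
  (* The inclusion of events holds up to a [P i]-null set; equivalence makes the exceptional sets
     null for [P ord0], simultaneously for the finitely many [i]. *)
  have Z_null : {ae P ord0, forall w, forall i, Z i w <= 0 -> g0 m.+1 w <= 0}.
    apply: filter_forall => i.
    apply: ae_dominated (hMequiv _ _ (MP ord0) (MP i)) _.
    have [hZ _] := HZ i; apply: is_condexp_null hZ _ => // w.
    exact: hg0_ge0.
  apply: filterS2 phi_le0 Z_null => w phiw Zw.
  (* The default value 1 of the minimum is positive, so [phi w] is positive as soon as all [Z i w]
     are. *)
  apply: contrapT => g0w; apply: phiw; apply/bigmin_gtP; split=> // i _.
  rewrite lt_max ltxx ltNge.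
  by apply/negP => Zi; apply: g0w; exact: Zw Zi.
- move=> i; have [hZ [Y hY YZ]] := HZ i; exists Y.
    by rewrite /stopped (minn_idPl mk).
  (* Almost surely the truncation at 0 is harmless, so [phi] is at most [Z i]. *)
  have Z0 : {ae P i, forall w, 0 <= Z i w}.
    by apply: is_condexp_ge0 hZ _ => // w; exact: hg0_ge0.
  apply: filterS2 YZ Z0 => w YZw Z0w.
  rewrite /stopped /= (minn_idPl (ltnW mk)) YZw.
  by apply: le_trans (bigmin_le _ i _) _; rewrite ge_max Z0w lexx.
Qed.

(** The stopped process takes only the values [f 0] to [f k], so the sum of their absolute values
    dominates it, with expectation controlled by the finite suprema of [class_F]. *)
Lemma stopped_dominated k : class_F M f ->
  exists (phi : Omega -> R) (T : R),
    [/\ measurable_fun setT phi,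
        forall m w, `|stopped f k m w| <= phi w &
        forall Q, M Q -> ('E_Q[phi] < T%:E)%E].
Proof.
move=> hfF; have [af _ _] := hf.
pose bound j : R := fine
  (ereal_sup [set 'E_P[fun w => (`|f j w|)%R] | P in M])%E.
(* An inequality suffices here: for empty [M] the supremum is [-oo], while [fine] returns 0. *)
have le_bound j :
    (ereal_sup [set 'E_P[fun w => (`|f j w|)%R] | P in M] <= (bound j)%:E)%E.
  by rewrite /bound; case: ereal_sup (hfF j) => // *; exact: leNye.
have mf j : measurable_fun setT (fun w => `|f j w|).
  exact/measurableT_comp/(measurable_wrtT (Fm j))/af.
(* The added 1 makes the bound by [T] strict. *)
exists (fun w => \sum_(j < k.+1) `|f j w|), (\sum_(j < k.+1) bound j + 1).
split=> [|m w|Q MQ].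
- by apply: measurable_sum => j; exact: mf.
- have mk : (minn m k < k.+1)%N by rewrite ltnS geq_minr.
  by rewrite (bigD1 (Ordinal mk))//= lerDl sumr_ge0.
apply: (@le_lt_trans _ _ (\sum_(j < k.+1) bound j)%:E).
  rewrite [leLHS](_ : _ = \sum_(j < k.+1) 'E_Q[fun w => (`|f j w|)%R])%E.
    rewrite -sumEFin; apply: lee_sum => j _.
    by apply: le_trans (le_bound j); apply: ereal_sup_ubound; exists Q.
  rewrite unlock; under eq_integral do rewrite -sumEFin.
  by rewrite ge0_integral_sum// => j; exact/measurable_EFinP.
by rewrite lte_fin ltrDl.
Qed.

Lemma stopped_regular k m : class_F M f ->
  (forall n P, (1 <= n)%N -> M P -> ('E_P[g0 n] < +oo)%E) -> (m < k)%N ->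
  (forall P, M P -> ~ {ae P, forall w, g0 m.+1 w <= 0}) ->
  regular F M (stopped f k).
Proof.
move=> hfF hg0_int mk g0_pos; split; first exact: stopped_supermartingale.
  exact: stopped_dominated.
(* [gbar] depends on [k] but not on the family of measures; it is set to 0 at time 0 and after
   [k]. *)
pose gbar n := if (0 < n <= k)%N then g0 n else cst 0.
exists gbar; rewrite {}/gbar; split.
- move=> n; case: ifP => [/andP[n0 _]|_]; first exact: hg0_adapted.
  exact: measurable_wrt_cst.
- by move=> n w; case: ifP => // /andP[n0 _]; exact: hg0_ge0.
- by [].
- move=> n P n0 MP; case: ifP => _; first exact: hg0_int.
  by rewrite expectation_cst ltry.
move=> s P MP _; split; first exact: stopped_regular_drop (g0_pos _ (MP ord0)).
have le_refl : process_le M (compensator k) (compensator k).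
  by move=> P' _ n; exact: aeW.
have [C Cmax Cc] := maximal_chain_containing le_refl (compensatorsP k MP).
exists C, (compensator k); split=> //.
- split=> // h Ch; apply: compensator_maximal => //.
  by have [CG _ _] := Cmax; exact: CG.
- by move=> j n i jn _; exact: compensated_condexp.
- case=> // n i _ /=.
  (* The increment of the compensator is [gbar n.+1] pointwise, so one version serves both
     conditional expectations. *)
  have -> : (fun w => compensator k n.+1 w - compensator k n w) =
      if (n < k)%N then g0 n.+1 else cst 0.
    by apply/funext => w; rewrite compensatorS addrC addKr; case: ifP.
  case: ltnP => nk; last first.
    have zero : is_condexp (P i) (F n) (cst 0) (cst 0).
      apply: is_condexp_refl; first exact: measurable_wrt_cst.
      exact: integrable0.
    by exists (cst 0).
  by have [Y [Z [_ hZ _]]] := hg0 n.+1 (P i) (ltn0Sn n) (MP i); exists Z.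
Qed.

End Regularity.

Theorem theorem2p7 (d : measure_display) (Omega : measurableType d)
    (R : realType) (F : nat -> set (set Omega))
    (M : set (probability Omega R)) (f g0 : nat -> Omega -> R)
    (hF : filtration F)
    (hMconv : convex_measures M) (hMequiv : equivalent_measures M)
    (hf : supermartingale F M f) (hfF : class_F M f)
    (hfnm : forall P, M P -> ~ martingale F [set P] f)
    (hg0_adapted : forall m, (1 <= m)%N -> measurable_wrt (F m) (g0 m))
    (hg0_ge0 : forall m w, (1 <= m)%N -> 0 <= g0 m w)
    (hg0_int : forall m P, (1 <= m)%N -> M P -> ('E_P[g0 m] < +oo)%E)
    (hg0 : forall m P, (1 <= m)%N -> M P ->
       exists Y Z : Omega -> R,
         [/\ is_condexp P (F m.-1) (f m) Y,
             is_condexp P (F m.-1) (g0 m) Z &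
             {ae P, forall w, f m.-1 w - Y w = Z w}]) :
  local_regular F M f.
Proof.
have [m0 g0_pos] := exists_nontrivial_drop hF hMequiv hf hg0_ge0 hg0 hfnm.
(* Every stopping time [s + m0.+1] exceeds [m0], so the nontrivial drop from [m0] to [m0.+1]
   survives each stopping. *)
split=> //; exists (fun s => (s + m0.+1)%N); split=> //.
- exact: cvg_addnr.
- move=> s.
  apply: (stopped_regular hF hMequiv hf hg0_adapted hg0_ge0 hg0) g0_pos => //.
  exact: leq_addl.
Qed.
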